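(* Let $d\ge2$ and let $G=(V,E)$ be a finite undirected $d$-regular graph, with gossip matrix $W=A(G)/d$, where $A(G)$ is the adjacency matrix of $G$. Let $\sigma(\mathbb{T}_d)$ be the spectral measure of the infinite $d$-regular tree $\mathbb{T}_d$, with gossip matrix $A(\mathbb{T}_d)/d$, at any vertex. Let $\xi=(\xi_v)_{v\in V}$ be real initial observations. Then for every $t\ge0$ the output $x^t=(x^t_v)_{v\in V}$ of the message passing algorithm on $G$ satisfies $$x^t=\pi_t(W)\xi,$$ where $\pi_0,\pi_1,\dots$ are the orthogonal polynomials with respect to the measure $(1-\lambda)\,\sigma(\mathbb{T}_d)(d\lambda)$, normalized such that $\pi_t(1)=1$.
   Context: Message passing algorithm on a graph $G$ ($\mathcal N(v)$ denotes the set of neighbors of $v$): for each ordered pair $(v,w)$ of adjacent vertices set $K^0_{vw}=0$, $M^0_{vw}=0$ and $$K^{t+1}_{vw}=1+\sum_{u\in\mathcal N(v),\,u\ne w}K^t_{uv},\qquad M^{t+1}_{vw}=\frac{1}{K^{t+1}_{vw}}\Big(\xi_v+\sum_{u\in\mathcal N(v),\,u\ne w}K^t_{uv}M^t_{uv}\Big).$$ The output at time $t$ is $$x^t_v=\frac{\xi_v+\sum_{u\in\mathcal N(v)}K^t_{uv}M^t_{uv}}{1+\sum_{u\in\mathcal N(v)}K^t_{uv}}.$$ Spectral measure: for a (possibly infinite, locally finite) graph with vertex set $V$, a symmetric stochastic nonnegative matrix $W$ supported on its edges and a vertex $v$, the spectral measure is the unique positive measure $\sigma$ on $[-1,1]$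 such that $\langle e_v,P(W)e_v\rangle_{\ell^2(V)}=\int_{-1}^1P(\lambda)\,d\sigma(\lambda)$ for every polynomial $P$. For the $d$-regular tree with $W=A(\mathbb{T}_d)/d$ it does not depend on $v$. Orthogonal polynomials with respect to a measure $\tau$: polynomials $\pi_t$ with $\deg\pi_t=t$ and $\int\pi_s\pi_t\,d\tau=0$ for $s\ne t$; they are unique up to rescaling each polynomial. *)

(* Defs.v *)
From HB Require Import structures.
From mathcomp Require Import all_boot all_order all_algebra.
From mathcomp Require Import all_classical all_reals all_analysis.
From mathcomp Require Import measurable_realfun.

Set Implicit Arguments.
Unset Strict Implicit.
Unset Printing Implicit Defensive.

Import Order.TTheory GRing.Theory Num.Theory.
Import numFieldNormedType.Exports.

Local Open Scope classical_set_scope.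
Local Open Scope ring_scope.

Definition simple_graph (V : eqType) (e : rel V) : Prop :=
  symmetric e /\ irreflexive e.

(* [`I_d] is the set of natural numbers below d; the vertex set may be
   infinite. *)
Definition regular_graph (V : Type) (d : nat) (e : rel V) : Prop :=
  forall v, ([set w | e v w] #= `I_d)%card.

Definition connected_graph (V : eqType) (e : rel V) : Prop :=
  forall v w, exists2 p : seq V, path e v p & last v p = w.

(* In a simple graph, a duplicate-free closed walk on at most two vertices is
   empty or runs back and forth along one edge; the longer ones are the graph
   cycles. *)
Definition acyclic_graph (V : eqType) (e : rel V) : Prop :=
  forall c : seq V, ucycle e c -> (size c <= 2)%N.

Definition regular_tree (U : eqType) (d : nat) (e : rel U) : Prop :=
  [/\ simple_graph e, regular_graph d e, connected_graph e & acyclic_graph e].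

Section Matrices.
Context {R : realType} {V : choiceType}.

(* A matrix indexed by V is a function V -> V -> R.  The sums over V below are
   finitely supported sums (a sum with infinite support is 0 by convention):
   the rows of W are to be finitely supported, as they are for a matrix
   supported on the edges of a locally finite graph, and so is one of the two
   arguments of [inner]. *)
Definition mxact (W : V -> V -> R) (f : V -> R) : V -> R :=
  fun v => \sum_(w \in [set: V]) W v w * f w.

Definition polyact (P : {poly R}) (W : V -> V -> R) (f : V -> R) : V -> R :=
  fun v => \sum_(i < size P) P`_i * iter i (mxact W) f v.

Definition inner (f g : V -> R) : R := \sum_(w \in [set: V]) f w * g w.

Definition basis_vec (v : V) : V -> R := fun w => (w == v)%:R.

Definition gossip (d : nat) (e : rel V) : V -> V -> R :=
  fun v w => (e v w)%:R / d%:R.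

(* A measure on [-1, 1] is encoded as a measure on R null outside [-1, 1]. *)
Definition spectral_measure (W : V -> V -> R) (v : V)
    (sigma : {measure set (measurableTypeR R) -> \bar R}) : Prop :=
  sigma (~` `[-1, 1]) = 0%E /\
  forall P : {poly R},
    (\int[sigma]_(x in `[(-1)%R, 1%R]) (P.[x])%:E =
     (inner (basis_vec v) (polyact P W (basis_vec v)))%:E)%E.

End Matrices.

Section ModifiedMeasure.
Context {R : realType}.
Variable sigma : {measure set (measurableTypeR R) -> \bar R}.

(* (1 - lambda) sigma(d lambda), for sigma supported in [-1, 1]. *)
Definition modified_measure (A : set (measurableTypeR R)) : \bar R :=
  (\int[sigma]_(x in A `&` `[(-1)%R, 1%R]) (1 - x)%:E)%E.

Let modified_measure0 : modified_measure set0 = 0%E.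
Proof. by rewrite /modified_measure set0I integral_set0. Qed.

Let modified_measure_ge0 A : (0 <= modified_measure A)%E.
Proof.
apply: integral_ge0 => x [_ /=]; rewrite in_itv /= => /andP[_ x1].
by rewrite lee_fin subr_ge0.
Qed.

Let modified_measure_sigma_additive : semi_sigma_additive modified_measure.
Proof.
move=> /= F mF tF mUF; rewrite /modified_measure setI_bigcupl.
rewrite ge0_integral_bigcup //=.
- apply: is_cvg_ereal_nneg_natsum_cond => n _ _.
  exact: modified_measure_ge0.
- by move=> n; apply: measurableI => //; exact: measurable_itv.
- apply/measurable_EFinP; apply: measurable_funB => //.
- move=> x [n _ [_ /=]]; rewrite in_itv /= => /andP[_ x1].
  by rewrite lee_fin subr_ge0.
- exact: trivIset_setIr.
Qed.

HB.instance Definition _ := isMeasure.Build _ _ _ modified_measure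
  modified_measure0 modified_measure_ge0 modified_measure_sigma_additive.

End ModifiedMeasure.

(* [size (pi_ t) = t.+1] says that pi_ t has degree t. *)
Definition orthogonal_polys {R : realType}
    (tau : {measure set (measurableTypeR R) -> \bar R})
    (pi_ : nat -> {poly R}) : Prop :=
  (forall t, size (pi_ t) = t.+1) /\
  (forall s t, s != t -> (\int[tau]_x ((pi_ s).[x] * (pi_ t).[x])%:E = 0)%E).

Definition normalized_at1 {R : realType} (pi_ : nat -> {poly R}) : Prop :=
  forall t, (pi_ t).[1] = 1.

Section MessagePassing.
Context {R : realType} {V : finType}.
Variables (e : rel V) (xi : V -> R).

(* The messages are defined on all ordered pairs (v, w), but only their values
   on pairs of adjacent vertices are ever used. *)
Fixpoint Kmsg (t : nat) (v w : V) : R :=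
  if t is t'.+1 then 1 + \sum_(u | e v u && (u != w)) Kmsg t' u v else 0.

Fixpoint Mmsg (t : nat) (v w : V) : R :=
  if t is t'.+1 then
    (Kmsg t'.+1 v w)^-1 *
    (xi v + \sum_(u | e v u && (u != w)) Kmsg t' u v * Mmsg t' u v)
  else 0.

Definition mp_output (t : nat) (v : V) : R :=
  (xi v + \sum_(u | e v u) Kmsg t u v * Mmsg t u v) /
  (1 + \sum_(u | e v u) Kmsg t u v).

End MessagePassing.

(* Main.v *)
Require Import Defs.
From HB Require Import structures.
From mathcomp Require Import all_boot all_order all_algebra.
From mathcomp Require Import all_classical all_reals all_analysis.
From mathcomp Require Import measurable_realfun ring.

Set Implicit Arguments.
Unset Strict Implicit.
Unset Printing Implicit Defensive.

Import Order.TTheory GRing.Theory Num.Theory.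
Import numFieldNormedType.Exports.

Local Open Scope classical_set_scope.
Local Open Scope ring_scope.

(* Put y^t = K^t M^t, so that y^{t+1}_{vw} is xi_v plus the sum of y^t_{uv} over
   the neighbours u <> w of v, and let S^t_v be xi_v plus the sum of y^t_{uv}
   over all neighbours u of v, the numerator of the output.  From
   y^{t+1}_{vw} = S^t_v - y^t_{wv} one gets, on any d-regular graph,
   S^{t+2} = A S^{t+1} - (d - 1) S^t, i.e. S^t = B_t(W) xi with B_0 = 1,
   B_1 = 1 + d X and B_{t+2} = d X B_{t+1} - (d - 1) B_t; the denominator of the
   output is B_t(1).
   On the tree with xi = e_r, a nonzero y^t_{ur} would give a nonbacktracking
   closed walk at r, so <e_r, B_t(W) e_r> = S^t_r = 1 for every t.  Hence
   M(f) = <e_r, (1 - W) f(W) e_r>, which is the integral of f against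
   (1 - lambda) sigma, vanishes at B_t for t > 0 and is positive at B_0 = 1; by
   the recurrence M(X^k B_t) is 0 for k < t and positive for k = t.  So the
   B_t are orthogonal with nonzero norms, and every orthogonal family is
   proportional to them. *)

(** * Orthogonality for a linear functional on polynomials *)

Section OrthogonalPolynomials.
Context {R : fieldType} (M : {scalar {poly R}}).
Implicit Types (p : nat -> {poly R}) (f g q : {poly R}).

(** The value of [c] is recorded because [ballp_orthogonal] needs it to be nonzero. *)
Lemma poly_top_decomp n f g : (size f <= n.+1)%N -> size g = n.+1 ->
  exists2 c, (size (f - c *: g)%R <= n)%N & c = f`_n / g`_n.
Proof.
move=> sf sg; exists (f`_n / g`_n) => //.
have gn : g`_n != 0.
  have := lead_coef_eq0 g; rewrite lead_coefE sg /= => ->.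
  by rewrite -size_poly_gt0 sg.
apply/leq_sizeP => j; rewrite leq_eqVlt => /predU1P[<-|nj].
  by rewrite coefB coefZ divfK// subrr.
have gj : (size g <= j)%N by rewrite sg.
rewrite coefB coefZ (nth_default _ gj) (nth_default _ (leq_trans sf nj)).
by rewrite mulr0 subrr.
Qed.

(** With one polynomial in each degree, p_0, ..., p_{t-1} span the degrees below t; the induction
    splits off the top term. *)
Lemma orthogonal_lower_degree p q t : (forall s, size (p s) = s.+1) ->
  (forall s, (s < t)%N -> M (p s * q) = 0) ->
  forall f, (size f <= t)%N -> M (f * q) = 0.
Proof.
move=> sp; elim: t => [|t IH] pq f sf.
  by move: sf; rewrite leqn0 size_poly_eq0 => /eqP->; rewrite mul0r linear0.
have [c sfc _] := poly_top_decomp sf (sp t).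
rewrite -[f](subrK (c *: p t)) mulrDl linearD /= -scalerAl scalarZ /=.
by rewrite pq// mulr0 addr0 IH// => s st; apply: pq; exact: ltnW.
Qed.

(** The remainder r = q - c p_t has degree below t and is orthogonal to all p_s with s < t. Pairing
    it with the p_n of its top degree leaves a M(p_n p_n), so a = 0 and the degree drops until r =
    0. *)
Lemma orthogonal_unique p q t : (forall s, size (p s) = s.+1) ->
  (forall s u, (s < u)%N -> M (p s * p u) = 0) ->
  (forall s, M (p s * p s) != 0) ->
  (size q <= t.+1)%N -> (forall s, (s < t)%N -> M (p s * q) = 0) ->
  exists c, q = c *: p t.
Proof.
move=> sp pp pp0 sq pq.
have [c sr _] := poly_top_decomp sq (sp t).
exists c; apply/eqP; rewrite -subr_eq0; move: sr.
set r := q - _ => sr.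
have pr s : (s < t)%N -> M (p s * r) = 0.
  move=> st; rewrite mulrBr linearB /= pq// -scalerAr scalarZ /= pp//.
  by rewrite mulr0 subrr.
suff H n : (n <= t)%N -> (size r <= n)%N -> r == 0 by exact: (H t).
elim: n => [|n IH] nt; first by rewrite leqn0 size_poly_eq0.
move=> srn; have [a sra aE] := poly_top_decomp srn (sp n).
apply: (IH (ltnW nt)); suff a0 : a = 0 by move: sra; rewrite a0 scale0r subr0.
have := pr n nt; rewrite mulrC -[r in r * _](subrK (a *: p n)).
rewrite mulrDl linearD /= (orthogonal_lower_degree sp _ sra); last first.
  by move=> s; exact: pp.
rewrite add0r -scalerAl scalarZ /= => /eqP.
by rewrite mulf_eq0 (negbTE (pp0 n)) orbF => /eqP.
Qed.

End OrthogonalPolynomials.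

(** * Ball polynomials of the regular tree *)

Section BallPolynomials.
Context {R : realFieldType} (d : nat).
Implicit Types f g : {poly R}.

(** On the d-regular tree, B_t(W) sums a function over the ball of radius t about each vertex, and
    B_t(1) is the size of that ball. *)
Fixpoint ballp (t : nat) : {poly R} :=
  if t is s.+1 then
    if s is u.+1 then d%:R *: ('X * ballp s) - (d%:R - 1) *: ballp u
    else 1 + d%:R *: 'X
  else 1.

Arguments ballp : simpl never.

Lemma ballp1 : ballp 1 = 1 + d%:R *: 'X.
Proof. by []. Qed.

(* The common value at time t of the weights K^t_{vw} on a d-regular graph. *)
Fixpoint regular_weight (t : nat) : R :=
  if t is s.+1 then 1 + (d%:R - 1) * regular_weight s else 0.

Lemma ballpSS t :
  ballp t.+2 = d%:R *: ('X * ballp t.+1) - (d%:R - 1) *: ballp t.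
Proof. by []. Qed.

Lemma size_ballp t : (0 < d)%N -> size (ballp t) = t.+1.
Proof.
move=> d0; have dn : d%:R != 0 :> R by rewrite pnatr_eq0 -lt0n.
suff: size (ballp t) = t.+1 /\ size (ballp t.+1) = t.+2 by case.
elim: t => [|t [IH1 IH2]].
  split; rewrite ?size_poly1// ballp1 addrC size_polyDl.
    by rewrite size_scale ?size_polyX.
  by rewrite size_scale ?size_polyX ?size_poly1.
split=> //; rewrite ballpSS size_polyDl size_scale// mulrC size_mulX ?IH2//.
- by rewrite -size_poly_eq0 IH2.
- by rewrite size_polyN (leq_ltn_trans (size_scale_leq _ _))// IH1.
- by rewrite -size_poly_eq0 IH2.
Qed.

Lemma ballp_at1 t : (ballp t).[1] = 1 + d%:R * regular_weight t.
Proof.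
pose P s := (ballp s).[1] = 1 + d%:R * regular_weight s.
suff: P t /\ P t.+1 by case.
elim: t => [|t [IH1 IH2]]; split=> //; rewrite /P.
- by rewrite /= hornerC mulr0 addr0.
- by rewrite ballp1 !hornerE /= mulr0 addr0 mulr1.
by rewrite ballpSS !hornerE IH1 IH2 /=; ring.
Qed.

Lemma regular_weight_ge0 t : (0 < d)%N -> 0 <= regular_weight t.
Proof.
move=> d0; elim: t => //= t IH.
by rewrite addr_ge0// mulr_ge0// subr_ge0 ler1n.
Qed.

(* If [L f] is the integral of f against a measure, [modified L f] is the one
   against (1 - lambda) times that measure. *)
Definition modified (L : {poly R} -> R) f := L ((1 - 'X) * f).

Lemma modified_is_linear (L : {scalar {poly R}}) : scalar (modified L).
Proof.
by move=> a f g; rewrite /modified mulrDr -scalerAr linearD scalarZ.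
Qed.

HB.instance Definition _ (L : {scalar {poly R}}) :=
  GRing.isLinear.Build R {poly R} R *%R (modified L) (modified_is_linear L).

Lemma ballp_orthogonal (L : {scalar {poly R}}) : (1 < d)%N ->
  (forall t, L (ballp t) = 1) ->
  (forall s t, (s < t)%N -> modified L (ballp s * ballp t) = 0) /\
  (forall t, modified L (ballp t * ballp t) != 0).
Proof.
move=> d1 LB; pose M : {scalar {poly R}} := modified L.
have ML f : M f = L ((1 - 'X) * f) by [].
rewrite -[modified L]/(M : _ -> _).
have d0 : (0 < d)%N by exact: ltnW.
have dn : 0 < d%:R :> R by rewrite ltr0n.
have dn1 : 0 < d%:R - 1 :> R by rewrite subr_gt0 ltr1n.
(* By the recurrence, d L(X B_{t+1}) = L(B_{t+2}) + (d - 1) L(B_t) = d, which is also d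
   L(B_{t+1}). *)
have MBS t : M (ballp t.+1) = 0.
  apply: (mulfI (lt0r_neq0 dn)).
  rewrite mulr0 ML mulrBl mul1r linearB /= mulrBr.
  have -> : d%:R * L ('X * ballp t.+1) = L (ballp t.+2 + (d%:R - 1) *: ballp t).
    by rewrite ballpSS subrK scalarZ.
  by rewrite linearD scalarZ /= !LB; ring.
(* L(B_1) = L(1) = 1 forces L(X) = 0, hence M(1) = 1. *)
have M1 : 0 < M 1.
  have : L (ballp 1) = 1 by [].
  rewrite ML mulr1 linearB linearD scalarZ /= -[1]/(ballp 0) LB => /eqP.
  rewrite -subr_eq0 addrC addKr mulf_eq0 gt_eqF//= => /eqP->.
  by rewrite subr0.
have step k t : d%:R * M ('X^(k.+1) * ballp t.+1) =
    M ('X^k * ballp t.+2) + (d%:R - 1) * M ('X^k * ballp t).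
  rewrite -!scalarZ -linearD /=; congr (M _).
  by rewrite ballpSS mulrBr -!scalerAr subrK mulrA -exprSr.
(* [step] trades one power of X for a shift of the index by 1 up or down. For k < t both terms
   vanish; for k = t only the lower one survives, with the positive factor d - 1. *)
have MX k : (forall t, (k < t)%N -> M ('X^k * ballp t) = 0) /\
    0 < M ('X^k * ballp k).
  elim: k => [|k [IH0 IHp]].
    by split=> [[//|t] _|]; rewrite expr0 mul1r.
  split=> [[//|t] kt|].
    apply: (mulfI (lt0r_neq0 dn)).
    by rewrite mulr0 step !IH0 ?mulr0 ?addr0// ltnW// ltnW.
  by rewrite -(pmulr_rgt0 _ dn) step IH0// add0r mulr_gt0.
have MB (f : {poly R}) t : (size f <= t)%N -> M (f * ballp t) = 0.
  apply: (@orthogonal_lower_degree _ _ (fun k => 'X^k)) => [s|s st].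
    by rewrite size_polyXn.
  exact: (MX s).1.
split=> [s t st|t]; first by rewrite MB// size_ballp.
(* Only the leading term c X^t of the first factor contributes to M(B_t B_t). *)
have [c sc cE] := @poly_top_decomp _ t (ballp t) 'X^t
  (eq_leq (size_ballp t d0)) (size_polyXn _ _).
rewrite -[X in X * _](subrK (c *: 'X^t)) mulrDl linearD /= MB// add0r.
rewrite -scalerAl scalarZ /= mulf_neq0 ?(gt_eqF (MX t).2)// cE.
rewrite coefXn eqxx divr1; have := lead_coef_eq0 (ballp t).
by rewrite lead_coefE size_ballp//= => ->; rewrite -size_poly_eq0 size_ballp.
Qed.

End BallPolynomials.

(** * Linearity of P(W) f in the polynomial P *)

Section PolynomialAction.
Context {R : realType} {V : choiceType}.
Variables (W : V -> V -> R) (f : V -> R).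
Implicit Types P Q : {poly R}.

Lemma polyactE n P v : (size P <= n)%N ->
  polyact P W f v = \sum_(i < n) P`_i * iter i (mxact W) f v.
Proof.
move=> sP; rewrite /polyact.
rewrite (big_ord_widen _ (fun i => P`_i * iter i (mxact W) f v) sP).
rewrite big_mkcond; apply: eq_bigr => i _; case: ifPn => //.
by rewrite -leqNgt => /(nth_default 0)->; rewrite mul0r.
Qed.

(** The polynomial comes last so that a linear structure can be attached. *)
Definition polyact_at v P := polyact P W f v.

Lemma polyact_at_is_linear v : scalar (polyact_at v).
Proof.
move=> a P Q; rewrite /polyact_at; set n := maxn (size P) (size Q).
rewrite !(@polyactE n) ?leq_maxl ?leq_maxr//; last first.
  apply: leq_trans (size_polyD _ _) _.
  by rewrite geq_max leq_maxr andbT (leq_trans (size_scale_leq _ _)) ?leq_maxl.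
rewrite mulr_sumr -big_split; apply: eq_bigr => i _ /=.
by rewrite coefD coefZ mulrDl mulrA.
Qed.

HB.instance Definition _ v := GRing.isLinear.Build R {poly R} R *%R
  (polyact_at v) (polyact_at_is_linear v).

Lemma polyact_at1 v : polyact_at v 1 = f v.
Proof. by rewrite /polyact_at /polyact size_poly1 big_ord1 coefC mul1r. Qed.

End PolynomialAction.

(** * Nonbacktracking messages on a regular graph, finite or infinite *)

Section RegularGraph.
Context {R : realType} {V : choiceType} (d : nat) (e : rel V) (N : V -> seq V).
Hypotheses (d0 : (0 < d)%N) (sym_e : symmetric e).
Hypotheses (uniqN : forall v, uniq (N v)) (sizeN : forall v, size (N v) = d).
Hypothesis memN : forall v w, (w \in N v) = e v w.
Implicit Types (f : V -> R).

Let dn : d%:R != 0 :> R.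
Proof. by rewrite pnatr_eq0 -lt0n. Qed.

Lemma mxact_gossip f v :
  mxact (gossip d e) f v = d%:R^-1 * \sum_(w <- N v) f w.
Proof.
rewrite mulr_sumr fsbig_seq// /mxact /gossip.
rewrite -(fsbig_widen [set` N v] setT)//=; last first.
  by move=> w [_ /= /negP]; rewrite memN => /negbTE->; rewrite !mul0r.
by apply: eq_fsbigr => w; rewrite inE /= memN => ->; rewrite div1r.
Qed.

Lemma polyact_atX P f v : polyact_at (gossip d e) f v ('X * P) =
  d%:R^-1 * \sum_(w <- N v) polyact_at (gossip d e) f w P.
Proof.
rewrite /polyact_at (@polyactE _ _ _ _ (size P).+1); last first.
  by rewrite mulrC (leq_trans (size_polyMleq _ _))// size_polyX addn2.
rewrite big_ord_recl coefXM mul0r add0r /polyact exchange_big mulr_sumr /=.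
apply: eq_bigr => i _; rewrite coefXM /= mxact_gossip mulrCA mulr_sumr.
by [].
Qed.

(* [nbmsg f t v w] and [nbtotal f t v] are y^t_{vw} and S^t_v for xi = f. *)
Fixpoint nbmsg f (t : nat) (v w : V) : R :=
  if t is s.+1 then f v + \sum_(u <- N v | u != w) nbmsg f s u v else 0.

Definition nbtotal f t v := f v + \sum_(u <- N v) nbmsg f t u v.

Lemma nbmsgS f t v w : w \in N v ->
  nbmsg f t.+1 v w = nbtotal f t v - nbmsg f t w v.
Proof.
move=> wv; rewrite /nbtotal /= -addrA (bigD1_seq w)//=.
by rewrite [nbmsg _ _ _ _ + _]addrC addrK.
Qed.

(** Peeling off the backtracking term twice gives f(v) + sum_u S^{t+1}_u - d S^t_v + sum_u y^t_{uv},
    and the last sum is S^t_v - f(v). *)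
Lemma nbtotalSS f t v : nbtotal f t.+2 v =
  \sum_(u <- N v) nbtotal f t.+1 u - (d%:R - 1) * nbtotal f t v.
Proof.
have Nsym u : u \in N v -> v \in N u by rewrite !memN sym_e.
rewrite {1}/nbtotal big_seq.
under eq_bigr => u uv do rewrite nbmsgS ?Nsym//.
rewrite -big_seq sumrB [X in _ - X]big_seq.
under [X in _ - X]eq_bigr => u uv do rewrite nbmsgS//.
rewrite -big_seq sumrB big_const_seq count_predT sizeN iter_addr_0.
rewrite -[_ *+ d]mulr_natl {4}/nbtotal; rewrite {2}/nbtotal.
ring.
Qed.

(** Serves twice: for the output on the finite graph and for L(B_t) on the tree. *)
Lemma nbtotal_ballp f t v :
  nbtotal f t v = polyact_at (gossip d e) f v (ballp d t).
Proof.
suff: (forall v, nbtotal f t v = polyact_at (gossip d e) f v (ballp d t)) /\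
      (forall v, nbtotal f t.+1 v = polyact_at (gossip d e) f v (ballp d t.+1)).
  by case.
elim: t {v} => [|t [IH1 IH2]].
  split=> v; first by rewrite /nbtotal big1 // addr0 polyact_at1.
  rewrite linearD scalarZ /= polyact_at1 -['X]mulr1 polyact_atX.
  rewrite mulrA divff// mul1r.
  rewrite /nbtotal; congr (_ + _); apply: eq_bigr => u _ /=.
  by rewrite big1 ?addr0 ?polyact_at1.
split=> // v; rewrite nbtotalSS ballpSS linearB !scalarZ /= polyact_atX.
rewrite mulrA divff// mul1r.
by rewrite IH1; congr (_ - _); apply: eq_bigr => u _.
Qed.

End RegularGraph.

(** * Walks in an acyclic graph *)

Section TreeWalks.
Context {V : choiceType} (e : rel V).

Fixpoint nonbacktracking (s : seq V) : bool :=
  if s is x :: s' then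
    (if s' is _ :: z :: _ then x != z else true) && nonbacktracking s'
  else true.

(** If the head x recurs in the duplicate-free tail, the stretch up to its return is a
    duplicate-free closed walk, of length at most 2 by acyclicity. Length 1 would be a loop, length
    2 a backtrack. *)
Lemma nonbacktracking_uniq s : irreflexive e -> acyclic_graph e ->
  sorted e s -> nonbacktracking s -> uniq s.
Proof.
move=> irr_e acy_e; elim: s => // x s IH /= es /andP[xs nbs].
have us : uniq s by rewrite IH// (path_sorted es).
rewrite us andbT; apply/negP => x_s.
have [p1 [p2 sE]] : exists p1 p2, s = p1 ++ x :: p2.
  by move: x_s => /splitPr[p1 p2]; exists p1, p2.
move: us es xs; rewrite {}sE cat_uniq /= => /and3P[up1 /norP[xp1 _] _].
rewrite -cat_rcons cat_path => /andP[ep1 _].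
have := acy_e (x :: p1); rewrite /ucycle /= ep1 xp1 up1 => /(_ isT).
case: p1 ep1 {up1 xp1} => [|y [|]]//=; first by rewrite irr_e.
by rewrite eqxx.
Qed.

Context {R : realType} (N : V -> seq V) (r : V).
Hypotheses (sym_e : symmetric e) (memN : forall v w, (w \in N v) = e v w).

(** A nonzero message must carry the value at [r]. Tracing it upstream gives the walk, and the
    condition [u != w] in the sum keeps it nonbacktracking. *)
Lemma nbmsg_walk t v w : nbmsg N (basis_vec r : V -> R) t v w != 0 -> e v w ->
  exists s, [/\ last v s = r, sorted e [:: w, v & s] &
                nonbacktracking [:: w, v & s]].
Proof.
elim: t v w => [|t IH] v w /=; first by rewrite eqxx.
have [->|rv] := eqVneq v r.
  by move=> _ erw; exists [::]; rewrite /= sym_e erw.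
rewrite /basis_vec (negbTE rv) add0r => nz evw.
have /hasP[u] : has (fun u =>
    (u != w) && (nbmsg N (basis_vec r : V -> R) t u v != 0)) (N v).
  apply: contraNT nz => /hasPn H; rewrite big1_seq// => u /andP[uw /H].
  by rewrite uw /= negbK => /eqP.
rewrite memN => evu /andP[uw] /IH; rewrite sym_e => /(_ evu)[s [ls es nbs]].
exists (u :: s); split=> //; first by rewrite /= sym_e evw.
by rewrite /= eq_sym uw.
Qed.

Lemma nbtotal_tree_root t : irreflexive e -> acyclic_graph e ->
  nbtotal N (basis_vec r : V -> R) t r = 1.
Proof.
move=> irr_e acy_e; rewrite /nbtotal /basis_vec eqxx.
rewrite big1_seq ?addr0// => u /andP[_]; rewrite memN sym_e => eur.
apply/eqP/negPn/negP => /nbmsg_walk/(_ eur)[s [ls es nbs]].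
have := nonbacktracking_uniq irr_e acy_e es nbs.
by rewrite /= -{1}ls mem_last.
Qed.

End TreeWalks.

Lemma inner_basis_vec {R : realType} {V : choiceType} (v : V) (f : V -> R) :
  inner (basis_vec v) f = f v.
Proof.
rewrite /inner -(fsbig_widen [set v] setT)//= ?fsbig_set1 /basis_vec.
  by rewrite eqxx mul1r.
by move=> w [_ /= /eqP/negbTE->]; rewrite mul0r.
Qed.

(** Neighbour lists let the same lemmas serve the finite graph and the tree. *)
Lemma regular_graph_neighbours {V : choiceType} d (e : rel V) :
  regular_graph d e ->
  exists N : V -> seq V, [/\ forall v, uniq (N v), forall v, size (N v) = d &
    forall v w, (w \in N v) = e v w].
Proof.
move=> reg; exists (fun v => finmap.enum_fset (fset_set [set w | e v w])).
have fin v : finite_set [set w | e v w] by apply/finite_setP; exists d.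
split=> v; [exact: finmap.fset_uniq|exact: card_fset_set|move=> w].
by rewrite in_fset_set//; apply/idP/idP; rewrite inE.
Qed.

(** * Message passing on the finite graph *)

Section FiniteGraph.
Context {R : realType} {V : finType} (d : nat) (e : rel V) (N : V -> seq V).
Hypotheses (d0 : (0 < d)%N) (sym_e : symmetric e).
Hypotheses (uniqN : forall v, uniq (N v)) (sizeN : forall v, size (N v) = d).
Hypothesis memN : forall v w, (w \in N v) = e v w.
Variable xi : V -> R.

Lemma sum_neighbours (P : pred V) (F : V -> R) v :
  \sum_(u | e v u && P u) F u = \sum_(u <- N v | P u) F u.
Proof.
rewrite big_mkcondr -[RHS]big_filter [RHS]big_uniq ?filter_uniq//.
rewrite -big_mkcondr; apply: eq_bigl => u.
by rewrite mem_filter memN andbC.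
Qed.

Lemma Kmsg_regular t v w : e v w -> Kmsg e t v w = regular_weight d t :> R.
Proof.
elim: t v w => //= t IH v w evw; congr (_ + _).
rewrite (eq_bigr (fun=> regular_weight d t)); last first.
  by move=> u /andP[evu _]; rewrite IH// sym_e.
(* Adding back the term of [w] gives a sum over all d neighbours. *)
rewrite sum_neighbours; apply: (addrI (regular_weight d t)).
rewrite -(bigD1_seq w)//= ?memN// big_const_seq count_predT sizeN iter_addr_0.
by move: (regular_weight d t) => k; rewrite mulrBl mul1r addrC subrK mulr_natl.
Qed.

Lemma KMmsg t v w : e v w -> Kmsg e t v w * Mmsg e xi t v w = nbmsg N xi t v w.
Proof.
elim: t v w => [|t IH] v w evw; first by rewrite mul0r.
rewrite [Mmsg _ _ _ _ _]/= mulVKf; last first.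
  rewrite Kmsg_regular// gt_eqF//= ltr_wpDr// mulr_ge0 ?regular_weight_ge0//.
  by rewrite subr_ge0 ler1n.
rewrite /= -sum_neighbours; congr (_ + _); apply: eq_bigr => u /andP[evu _].
by rewrite IH// sym_e.
Qed.

Lemma mp_outputE t v :
  mp_output e xi t v = nbtotal N xi t v / (1 + d%:R * regular_weight d t).
Proof.
have sumN (F : V -> R) : \sum_(u | e v u) F u = \sum_(u <- N v) F u.
  by rewrite -(sum_neighbours xpredT); apply: eq_bigl => u; rewrite andbT.
rewrite /mp_output; congr ((_ + _) / (_ + _)).
  by rewrite -sumN; apply: eq_bigr => u evu; rewrite KMmsg// sym_e.
rewrite (eq_bigr (fun=> regular_weight d t)); last first.
  by move=> u evu; rewrite Kmsg_regular// sym_e.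
by rewrite sumN big_const_seq count_predT sizeN iter_addr_0 mulr_natl.
Qed.

End FiniteGraph.

(** * Integration against a measure with a density *)

Section IntegralDensity.
Context dp (T : measurableType dp) (R : realType).
Variables (mu nu : {measure set T -> \bar R}) (g : T -> R).
Hypotheses (mg : measurable_fun setT g) (g_ge0 : forall x, 0 <= g x).
Hypothesis nuE : forall A, measurable A ->
  nu A = (\int[mu]_(x in A) (g x)%:E)%E.

Import HBNNSimple.

(** Linearity over the level sets of [h] reduces this to [nuE]. *)
Lemma integral_density_nnsfun (h : {nnsfun T >-> R}) :
  (\int[nu]_x (h x)%:E = \int[mu]_x (h x * g x)%:E)%E.
Proof.
have mI y : measurable (h @^-1` [set y]) by exact: measurable_sfunP.
have hge0 y x : 0 <= y * \1_(h @^-1` [set y]) x.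
  by rewrite -lee_fin EFinM nnfun_muleindic_ge0.
transitivity (\sum_(y \in range h)
    (\int[mu]_x ((y * \1_(h @^-1` [set y]) x) * g x)%:E)%E).
  rewrite integral_nnsfun// patch_setT sintegralE; apply: eq_fsbigr => y.
  rewrite inE => -[z _ <-]; under [RHS]eq_integral do rewrite -mulrA EFinM.
  rewrite ge0_integralZl_EFin//.
  - congr (_ * _)%E; rewrite nuE// integral_mkcond epatch_indic.
    by apply: eq_integral => x _; rewrite /= -EFinM mulrC.
  - by move=> x _; rewrite lee_fin mulr_ge0.
  - by apply/measurable_EFinP; exact: measurable_funM.
rewrite -ge0_integral_fsum//=.
- by apply: eq_integral => x _; rewrite fsumEFin// -mulr_fsuml -fimfunE.
- move=> y; apply/measurable_EFinP; apply: measurable_funM => //.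
  exact: measurable_funM.
- by move=> y x _; rewrite lee_fin mulr_ge0.
Qed.

Lemma ge0_integral_density (f : T -> \bar R) : measurable_fun setT f ->
  (forall x, 0 <= f x)%E -> (\int[nu]_x f x = \int[mu]_x (f x * (g x)%:E))%E.
Proof.
move=> mf f0; pose h := nnsfun_approx measurableT mf.
have hf x : (h n x)%:E @[n --> \oo] --> f x.
  by apply: cvg_nnsfun_approx.
have hnd x : {homo (fun n => h n x) : n m / (n <= m)%N >-> n <= m}.
  by move=> n m nm; exact/lefP/nd_nnsfun_approx.
transitivity (\int[nu]_x limn (fun n => (h n x)%:E))%E.
  by apply: eq_integral => x _; apply/esym/cvg_lim.
rewrite monotone_convergence//=; last 3 first.
- by move=> n; exact/measurable_EFinP.
- by move=> n x _; rewrite lee_fin.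
- by move=> x _ n m nm; rewrite lee_fin; exact: hnd.
under eq_fun do rewrite integral_density_nnsfun.
rewrite -monotone_convergence//=; last 3 first.
- by move=> n; apply/measurable_EFinP; exact: measurable_funM.
- by move=> n x _; rewrite lee_fin mulr_ge0.
- by move=> x _ n m nm; rewrite lee_fin ler_wpM2r//; exact: hnd.
apply: eq_integral => x _; apply/cvg_lim => //.
by under eq_fun do rewrite EFinM; exact: cvgeZr.
Qed.

(** As g >= 0, multiplying by g respects positive and negative parts, and each falls under the
    nonnegative case. *)
Lemma integral_density (f : T -> R) : measurable_fun setT f ->
  (\int[nu]_x (f x)%:E = \int[mu]_x (f x * g x)%:E)%E.
Proof.
move=> mf; have mEf : measurable_fun setT (EFin \o f) by exact/measurable_EFinP.
rewrite integralE [RHS]integralE.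
rewrite !ge0_integral_density//; last 2 first.
- exact: measurable_funeneg.
- exact: measurable_funepos.
congr (_ - _)%E; apply: eq_integral => x _.
  by rewrite !funeposE -!EFin_max -EFinM maxr_pMl// mul0r.
by rewrite !funenegE -!EFinN -!EFin_max -EFinM maxr_pMl// mul0r mulNr.
Qed.

End IntegralDensity.

Lemma measurable_horner {R : realType} (P : {poly R}) :
  measurable_fun setT (horner P : R -> R).
Proof. by apply: continuous_measurable_fun => x; exact: continuous_horner. Qed.

Lemma integral_modified_measure {R : realType}
    (sigma : {measure set (measurableTypeR R) -> \bar R}) (P : {poly R}) :
  (\int[modified_measure sigma]_x (P.[x])%:E =
   \int[sigma]_(x in `[(-1)%R, 1%R]) (((1 - 'X) * P).[x])%:E)%E.
Proof.
(* Cutting 1 - x off outside [-1, 1] makes the density nonnegative on the whole line. *)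
pose g := (fun x : R => 1 - x) \_ `[(-1)%R, 1%R].
rewrite (@integral_density _ _ _ sigma _ g); last 4 first.
- apply/(measurable_restrictT _ _).1; first exact: measurable_itv.
  exact: measurable_funB.
- move=> x; rewrite /g patchE; case: ifPn => //.
  by rewrite inE/= in_itv/= => /andP[_]; rewrite subr_ge0.
- move=> A mA; rewrite -[LHS]/(modified_measure sigma A) /modified_measure.
  rewrite integral_mkcondr; apply: eq_integral => x _.
  by rewrite /g !patchE; case: ifP.
- exact: measurable_horner.
rewrite [RHS]integral_mkcond; apply: eq_integral => x _.
rewrite /g !patchE; case: ifP => _; last by rewrite mulr0.
by rewrite hornerM !hornerE mulrC.
Qed.

Theorem theorem9p2 (R : realType) (d : nat) (hd : (2 <= d)%N)
    (V : finType) (e : rel V)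
    (simple_e : simple_graph e) (regular_e : regular_graph d e)
    (U : choiceType) (eT : rel U) (tree_eT : regular_tree d eT) (r : U)
    (sigma : {measure set (measurableTypeR R) -> \bar R})
    (spectral_sigma : spectral_measure (gossip d eT) r sigma)
    (xi : V -> R) :
  (exists pi_ : nat -> {poly R},
     orthogonal_polys (modified_measure sigma) pi_ /\ normalized_at1 pi_) /\
  (forall pi_ : nat -> {poly R},
     orthogonal_polys (modified_measure sigma) pi_ -> normalized_at1 pi_ ->
     forall (t : nat) (v : V),
       mp_output e xi t v = polyact (pi_ t) (gossip d e) xi v).
Proof.
have d0 : (0 < d)%N by exact: ltnW.
have [[sym_e _] [[symT irrT] regT _ acyT]] := (simple_e, tree_eT).
have [N [uniqN sizeN memN]] := regular_graph_neighbours regular_e.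
have [NT [uniqNT sizeNT memNT]] := regular_graph_neighbours regT.
pose L : {scalar {poly R}} := polyact_at (gossip d eT) (basis_vec r) r.
have LB t : L (ballp d t) = 1.
  rewrite -[LHS]/(polyact_at _ _ _ _).
  rewrite -(nbtotal_ballp d0 symT uniqNT sizeNT memNT).
  exact: nbtotal_tree_root.
pose M : {scalar {poly R}} := modified L.
have intE P : (\int[modified_measure sigma]_x (P.[x])%:E = (M P)%:E)%E.
  by rewrite integral_modified_measure spectral_sigma.2 inner_basis_vec.
have intME P Q : (\int[modified_measure sigma]_x (P.[x] * Q.[x])%:E =
    (M (P * Q))%:E)%E.
  by rewrite -intE; apply: eq_integral => x _; rewrite hornerM.
have [orthB normB] : (forall s t, (s < t)%N -> M (ballp d s * ballp d t) = 0) /\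
    (forall t, M (ballp d t * ballp d t) != 0) := ballp_orthogonal hd LB.
have B1 t : (ballp d t).[1] != 0 :> R.
  rewrite ballp_at1 gt_eqF// ltr_wpDr// mulr_ge0//.
  exact: regular_weight_ge0.
split.
  exists (fun t => (ballp d t).[1]^-1 *: ballp d t); split; last first.
    by move=> t; rewrite hornerZ mulVf.
  split=> [t|s t st]; first by rewrite size_scale ?invr_eq0// size_ballp.
  rewrite intME -scalerAl scalarZ -scalerAr scalarZ.
  suff -> : M (ballp d s * ballp d t) = 0 by rewrite !mulr0.
  by have [/orthB|/orthB|/eqP] := ltngtP s t; rewrite ?(negbTE st)// mulrC.
move=> pi_ [size_pi orth_pi] pi1 t v.
have orthM s u : s != u -> M (pi_ s * pi_ u) = 0.
  by move=> su; apply: EFin_inj; rewrite -intME orth_pi.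
(* Orthogonality of [pi_] gives M(f pi_t) = 0 for all f of degree below t, in particular for B_s
   with s < t. Uniqueness is then applied to the B_s, whose norms are known to be nonzero. *)
have [c piE] : exists c, pi_ t = c *: ballp d t.
  apply: (orthogonal_unique (M := M)) => // [s||s st].
  - exact: size_ballp.
  - by rewrite size_pi.
  apply: (orthogonal_lower_degree (p := pi_) (t := t)) => //.
    by move=> u ut; rewrite orthM// neq_ltn ut.
  by rewrite size_ballp.
have cE : c = (ballp d t).[1]^-1.
  by apply: (mulIf (B1 t)); rewrite mulVf// -hornerZ -piE.
(* The denominator of the output is B_t(1), that is 1/c. *)
rewrite (mp_outputE d0 sym_e uniqN sizeN memN) -ballp_at1.
rewrite (nbtotal_ballp d0 sym_e uniqN sizeN memN) mulrC -cE.
by rewrite -[RHS]/(polyact_at _ _ _ _) piE scalarZ.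
Qed.
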